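(* Let $f:A\to\mathcal{P}(\Lambda)$ and $g:B\to\mathcal{P}(K)$ be associated transition maps, where $\Lambda$ and $K$ carry the topologies generated by the closed bases $\{f(a)\mid a\in A\}$ and $\{g(b)\mid b\in B\}$ respectively, and suppose that $K$ is compact. Let $\sigma:\Lambda\to K$ be any continuous function. If there exists a ring homomorphism $\varphi:B\to A$ such that $f\circ\varphi=\sigma^{*}\circ g$, where $\sigma^{*}$ is defined by $T\mapsto\sigma^{-1}(T)$ for $T\in g(B)$ (that is, $f(\varphi(b))=\sigma^{-1}(g(b))$ for all $b\in B$), then $\sigma$ has a unique continuous extension to $\Omega_f(\Lambda)$; that is, there exists a unique continuous function $\overline{\sigma}:\Omega_f(\Lambda)\to K$ such that $\overline{\sigma}\circ i=\sigma$, where $i:\Lambda\to\Omega_f(\Lambda)$ is the map $\lambda\mapsto E_\lambda=\{f(a)\in f(A)\mid\lambda\in f(a)\}$.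
   Context: All rings are commutative with unity. $\mathcal{P}(\Lambda)$ is the power set of $\Lambda$. For a ring $D$ and a nonempty set $\Lambda$, a map $\psi:D\to\mathcal{P}(\Lambda)$ is a semi-transition map on $D$ if: (i) $\psi(ab)=\psi(a)\cup\psi(b)$ for all $a,b\in D$; (ii) $\psi(1)=\emptyset$, and $\psi(a)=\Lambda$ if and only if $a=0$; (iii) for all $a,b\in D$ there is some $c$ in the ideal $(a,b)$ with $\psi(a)\cap\psi(b)=\psi(c)\subseteq\psi(a+b)$; moreover, if $\psi(a)\cap\psi(b)=\emptyset$, then the ideal $(a^m,b^n)$ is principal for some $m,n\in\mathbb{N}$ (positive integers). A pm-ring is a ring in which each prime ideal is contained in a unique maximal ideal. A transition map on $D$ is a semi-transition map $\psi:D\to\mathcal{P}(\Lambda)$, where $D$ is a pm-ring, such that: (T1) if $\lambda_1\neq\lambda_2$ in $\Lambda$, then there is $a\in D$ such that $\psi(a)$ contains exactly one of $\lambda_1,\lambda_2$; (T2) for all $\lambda\in\Lambda$ and $a\in D$ with $\lambda\notin\psi(a)$, there is $b\in D$ with $\lambda\in\psi(b)$ and $\psi(a)\cap\psi(b)=\emptyset$. A ring is transitional if it is a pm-ring admitting a transition map. Given a transitional ring $D$ with transition map $\psi:D\to\mathcal{P}(\Lambda)$, put $S=\{d\in D\mid\psi(d)=\emptyset\}$ (multiplicatively closed); the associated transitional ring is $D_S=S^{-1}D$ and the associated transition map is $D_S\to\mathcal{P}(\Lambda)$, $d/s\mapsto\psi(d)$ (it is well defined and is a transition map). ''$f:A\to\mathcal{P}(\Lambda)$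 is an associated transition map'' means that $A\cong D_S$ for such a $D$ and $f$ is the corresponding associated transition map. An $f$-filter on $\Lambda$ is a nonempty subfamily $\mathscr{F}$ of $f(A)=\{f(a)\mid a\in A\}$ with $\emptyset\notin\mathscr{F}$, closed under finite intersections, and such that $f(a)\in\mathscr{F}$, $c\in A$ and $f(a)\subseteq f(c)$ imply $f(c)\in\mathscr{F}$; an $f$-ultrafilter is a maximal $f$-filter. $\Omega_f(\Lambda)$ is the set of all $f$-ultrafilters on $\Lambda$, topologized with closed base $\overline{f(a)}=\{\mathscr{U}\in\Omega_f(\Lambda)\mid f(a)\in\mathscr{U}\}$, $a\in A$. Each $E_\lambda$ is an $f$-ultrafilter, and $\lambda\in\Lambda$ is identified with $E_\lambda$. *)

(* Defs.v *)
From HB Require Import structures.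
From mathcomp Require Import all_boot all_order all_algebra.
From mathcomp Require Import generic_quotient ring_quotient finmap.
From mathcomp Require Import mathcomp_extra boolp classical_sets functions.
From mathcomp Require Import cardinality topology.
From mathcomp Require Import ring.

Set Implicit Arguments.
Unset Strict Implicit.
Unset Printing Implicit Defensive.

Import GRing.Theory.

Local Open Scope classical_set_scope.
Local Open Scope ring_scope.
Local Open Scope quotient_scope.

(* Rings are taken to be nontrivial: a semi-transition map has a nonempty     *)
(* target, which forces 1 != 0. Only the localization below may be trivial.   *)

Section Ideals.
Variable D : comNzRingType.

Definition maximal_ideal (M : {pred D}) : Prop :=
  idealr_closed M /\
  forall J : {pred D}, idealr_closed J -> {subset M <= J} -> J =i M.

Definition pm_ring : Prop :=
  forall P : {pred D}, idealr_closed P -> prime_idealr_closed P ->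
  exists M : {pred D}, [/\ maximal_ideal M, {subset P <= M} &
    forall N : {pred D}, maximal_ideal N -> {subset P <= N} -> N =i M].

Definition ideal2 (a b : D) : set D := [set x | exists r s, x = r * a + s * b].

Definition principal (I : set D) : Prop := exists c, I = [set r * c | r in setT].

End Ideals.

Section TransitionMaps.
Variables (D : comNzRingType) (L : Type).

Record semi_transition_map (psi : D -> set L) : Prop := SemiTransitionMap {
  st_nonempty : [set: L] !=set0;
  st_mul : forall a b, psi (a * b) = psi a `|` psi b;
  st_one : psi 1 = set0;
  st_full : forall a, psi a = setT <-> a = 0;
  st_add : forall a b, exists c,
    [/\ ideal2 a b c, psi a `&` psi b = psi c & psi c `<=` psi (a + b)];
  st_principal : forall a b, psi a `&` psi b = set0 ->
    exists m n, [/\ (0 < m)%N, (0 < n)%N & principal (ideal2 (a ^+ m) (b ^+ n))]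
}.

Record transition_map (psi : D -> set L) : Prop := TransitionMap {
  tm_pm : pm_ring D;
  tm_semi : semi_transition_map psi;
  tm_T1 : forall l1 l2, l1 <> l2 ->
    exists a, (psi a l1 /\ ~ psi a l2) \/ (psi a l2 /\ ~ psi a l1);
  tm_T2 : forall l a, ~ psi a l ->
    exists b, psi b l /\ psi a `&` psi b = set0
}.

End TransitionMaps.

Section Localization.
Variables (D : comNzRingType) (S : mulrClosed D).

Local Notation denom := {s : D | s \in S}.
Local Notation fraction_pair := (D * denom)%type.

Lemma denom1_subproof : 1 \in S. Proof. exact: rpred1. Qed.
Lemma denomM_subproof (s t : denom) : sval s * sval t \in S.
Proof. by apply: rpredM; exact: valP. Qed.

Definition denom1 : denom := Sub 1 denom1_subproof.
Definition denomM (s t : denom) : denom := Sub (sval s * sval t) (denomM_subproof s t).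

Implicit Types x y : fraction_pair.

Definition loc_equiv x y : bool :=
  `[< exists2 t, t \in S & t * (x.1 * sval y.2) = t * (y.1 * sval x.2) >].

Lemma loc_equiv_refl : reflexive loc_equiv.
Proof. by move=> x; apply/asboolP; exists 1; rewrite ?rpred1. Qed.

Lemma loc_equiv_sym : symmetric loc_equiv.
Proof.
by move=> x y; apply: asbool_equiv_eq; split=> -[t St e]; exists t.
Qed.

Lemma loc_equiv_trans : transitive loc_equiv.
Proof.
move=> [b [t Ht]] [a [s Hs]] [c [u Hu]] /asboolP[/= v Sv e1].
move=> /asboolP[/= w Sw e2]; apply/asboolP.
exists (v * w * t) => /=; first by do 2?apply: rpredM.
have -> : v * w * t * (a * u) = w * u * (v * (a * t)) by ring.
have -> : v * w * t * (c * s) = v * s * (w * (c * t)) by ring.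
by rewrite e1 -e2; ring.
Qed.

Canonical loc_equiv_equiv :=
  EquivRel loc_equiv loc_equiv_refl loc_equiv_sym loc_equiv_trans.

Definition localization : Type := {eq_quot loc_equiv}.
HB.instance Definition _ := EqQuotient.on localization.
HB.instance Definition _ := Choice.on localization.

Local Notation loc := localization.

Definition frac (d : D) (s : denom) : loc := \pi_loc ((d, s) : fraction_pair).

Lemma fracP (x : loc) : exists d s, x = frac d s.
Proof. by elim/quotW: x => -[d s]; exists d, s. Qed.

Lemma frac_eqP d s e u : frac d s = frac e u <->
  exists2 t, t \in S & t * (d * sval u) = t * (e * sval s).
Proof.
split=> [/eqmodP/asboolP//|h]; apply/eqmodP.
exact/asboolP.
Qed.

Definition addp x y : fraction_pair :=
  (x.1 * sval y.2 + y.1 * sval x.2, denomM x.2 y.2).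
Definition oppp x : fraction_pair := (- x.1, x.2).
Definition mulp x y : fraction_pair := (x.1 * y.1, denomM x.2 y.2).

Definition loc_add (x y : loc) : loc := \pi_loc (addp (repr x) (repr y)).
Definition loc_opp (x : loc) : loc := \pi_loc (oppp (repr x)).
Definition loc_mul (x y : loc) : loc := \pi_loc (mulp (repr x) (repr y)).

Lemma frac_repr d s : exists2 t, t \in S &
  t * ((repr (frac d s)).1 * sval s) = t * (d * sval (repr (frac d s)).2).
Proof.
have : frac (repr (frac d s)).1 (repr (frac d s)).2 = frac d s.
  by rewrite /frac -surjective_pairing reprK.
by move/frac_eqP.
Qed.

Lemma loc_addE d s e u : loc_add (frac d s) (frac e u) =
  frac (d * sval u + e * sval s) (denomM s u).
Proof.
have [t St ht] := frac_repr d s; have [v Sv hv] := frac_repr e u.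
rewrite /loc_add; move: (repr _) (repr _) ht hv => [e' u'] [d' s'] /= ht hv.
apply/frac_eqP; exists (t * v) => /=; first exact: rpredM.
set ss := sval s in ht *; set uu := sval u in hv *.
set ss' := sval s' in ht *; set uu' := sval u' in hv *.
have -> : t * v * ((d' * uu' + e' * ss') * (ss * uu)) =
  (t * (d' * ss)) * (v * uu' * uu) + (v * (e' * uu)) * (t * ss' * ss) by ring.
by rewrite ht hv; ring.
Qed.

Lemma loc_oppE d s : loc_opp (frac d s) = frac (- d) s.
Proof.
have [t St ht] := frac_repr d s.
rewrite /loc_opp; move: (repr _) ht => [d' s'] /= ht.
by apply/frac_eqP; exists t => //=; rewrite !mulNr !mulrN ht.
Qed.

Lemma loc_mulE d s e u : loc_mul (frac d s) (frac e u) =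
  frac (d * e) (denomM s u).
Proof.
have [t St ht] := frac_repr d s; have [v Sv hv] := frac_repr e u.
rewrite /loc_mul; move: (repr _) (repr _) ht hv => [e' u'] [d' s'] /= ht hv.
apply/frac_eqP; exists (t * v) => /=; first exact: rpredM.
set ss := sval s in ht *; set uu := sval u in hv *.
set ss' := sval s' in ht *; set uu' := sval u' in hv *.
have -> : t * v * (d' * e' * (ss * uu)) =
  (t * (d' * ss)) * (v * (e' * uu)) by ring.
by rewrite ht hv; ring.
Qed.

Lemma frac_eq d s e u : d * sval u = e * sval s -> frac d s = frac e u.
Proof. by move=> h; apply/frac_eqP; exists 1; rewrite ?rpred1 ?mul1r. Qed.

Lemma loc_addA : associative loc_add.
Proof.
move=> x y z; have [a [s ->]] := fracP x; have [b [t ->]] := fracP y.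
have [c [u ->]] := fracP z; rewrite !loc_addE; apply: frac_eq => /=; ring.
Qed.

Lemma loc_addC : commutative loc_add.
Proof.
move=> x y; have [a [s ->]] := fracP x; have [b [t ->]] := fracP y.
by rewrite !loc_addE; apply: frac_eq => /=; ring.
Qed.

Lemma loc_add0 : left_id (frac 0 denom1) loc_add.
Proof.
move=> x; have [a [s ->]] := fracP x.
by rewrite loc_addE; apply: frac_eq => /=; ring.
Qed.

Lemma loc_addN : left_inverse (frac 0 denom1) loc_opp loc_add.
Proof.
move=> x; have [a [s ->]] := fracP x.
by rewrite loc_oppE loc_addE; apply: frac_eq => /=; ring.
Qed.

HB.instance Definition _ :=
  GRing.isZmodule.Build loc loc_addA loc_addC loc_add0 loc_addN.

Lemma loc_mulA : associative loc_mul.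
Proof.
move=> x y z; have [a [s ->]] := fracP x; have [b [t ->]] := fracP y.
have [c [u ->]] := fracP z; rewrite !loc_mulE; apply: frac_eq => /=; ring.
Qed.

Lemma loc_mulC : commutative loc_mul.
Proof.
move=> x y; have [a [s ->]] := fracP x; have [b [t ->]] := fracP y.
by rewrite !loc_mulE; apply: frac_eq => /=; ring.
Qed.

Lemma loc_mul1 : left_id (frac 1 denom1) loc_mul.
Proof.
move=> x; have [a [s ->]] := fracP x.
by rewrite loc_mulE; apply: frac_eq => /=; ring.
Qed.

Lemma loc_mulDl : left_distributive loc_mul +%R.
Proof.
move=> x y z; have [a [s ->]] := fracP x; have [b [t ->]] := fracP y.
have [c [u ->]] := fracP z; have addE p q r w : frac p q + frac r w = loc_add (frac p q) (frac r w) by [].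
rewrite addE loc_addE !loc_mulE addE loc_addE.
by apply: frac_eq => /=; ring.
Qed.

HB.instance Definition _ := GRing.Zmodule_isComPzRing.Build loc
  loc_mulA loc_mulC loc_mul1 loc_mulDl.

Lemma fracM d s e u : frac d s * frac e u = frac (d * e) (denomM s u).
Proof. exact: loc_mulE. Qed.

Lemma fracD d s e u :
  frac d s + frac e u = frac (d * sval u + e * sval s) (denomM s u).
Proof. exact: loc_addE. Qed.

End Localization.

(* A is isomorphic to D_S for a transitional ring D, where S consists of the  *)
(* d with psi d empty, and f is the map d/s |-> psi d read through this       *)
(* isomorphism.                                                               *)
Definition associated_transition_map (A : comNzRingType) (L : Type)
    (f : A -> set L) : Prop :=
  exists (D : comNzRingType) (psi : D -> set L) (S : mulrClosed D)
         (h : {rmorphism localization S -> A}),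
  [/\ transition_map psi,
      forall d, (d \in S) <-> psi d = set0,
      bijective h &
      forall (d : D) (s : {s : D | s \in S}), f (h (frac d s)) = psi d].

Section AssociatedTheory.
Variables (A : comNzRingType) (L : Type) (f : A -> set L).
Hypothesis hf : associated_transition_map f.

Lemma associatedI a b : exists c, f a `&` f b = f c.
Proof.
have [D [psi [S [h [[_ psiT _ _] _ [k hk kh] fE]]]]] := hf.
have [d [s kaE]] := fracP (k a); have [e [u kbE]] := fracP (k b).
have [c [_ cE _]] := st_add psiT d e.
exists (h (frac c (denom1 S))).
by rewrite fE -cE -[a]kh -[b]kh kaE kbE !fE.
Qed.

Lemma associatedM a b : f (a * b) = f a `|` f b.
Proof.
have [D [psi [S [h [[_ psiT _ _] _ [k hk kh] fE]]]]] := hf.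
have [d [s kaE]] := fracP (k a); have [e [u kbE]] := fracP (k b).
by rewrite -[a]kh -[b]kh kaE kbE -rmorphM fracM !fE (st_mul psiT).
Qed.

Lemma associated0 : f 0 = setT.
Proof.
have [D [psi [S [h [[_ psiT _ _] _ _ fE]]]]] := hf.
by rewrite -(rmorph0 h) (fE 0 (denom1 S)); apply/(st_full psiT).
Qed.

Lemma associated1 : f 1 = set0.
Proof.
have [D [psi [S [h [[_ psiT _ _] _ _ fE]]]]] := hf.
by rewrite -(rmorph1 h) (fE 1 (denom1 S)); exact: st_one.
Qed.

Lemma associated_sep l a : ~ f a l -> exists b, f b l /\ f a `&` f b = set0.
Proof.
have [D [psi [S [h [[_ _ _ psiT2] _ [k hk kh] fE]]]]] := hf.
have [d [s kaE]] := fracP (k a); rewrite -[a]kh kaE fE => /psiT2[b [bl db]].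
by exists (h (frac b (denom1 S))); rewrite fE.
Qed.

End AssociatedTheory.

Section Ultrafilters.
Variables (A : comNzRingType) (L : Type) (f : A -> set L).

Record f_filter (F : set (set L)) : Prop := FFilter {
  ff_sub : F `<=` range f;
  ff_nonempty : F !=set0;
  ff_set0 : ~ F set0;
  ff_setI : forall X Y, F X -> F Y -> F (X `&` Y);
  ff_up : forall a c, F (f a) -> f a `<=` f c -> F (f c)
}.

Definition f_ultrafilter (U : set (set L)) : Prop :=
  f_filter U /\ forall V, f_filter V -> U `<=` V -> V = U.

Definition E_ (l : L) : set (set L) := [set X | range f X /\ X l].

Lemma E_ultrafilter l : associated_transition_map f -> f_ultrafilter (E_ l).
Proof.
move=> hf; split.
  split.
  - by move=> X [].
  - by exists (f 0); split; [exists 0|rewrite (associated0 hf)].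
  - by case.
  - move=> X Y [[a _ <-] al] [[b _ <-] bl]; split=> //.
    by have [c ->] := associatedI hf a b; exists c.
  - by move=> a c [_ al] ac; split; [exists c|exact: ac].
move=> V Vf EV; apply/seteqP; split=> // X VX.
have [a _ aX] := ff_sub Vf VX; split; first by exists a.
apply: contrapT; rewrite -aX => /(associated_sep hf)[b [bl ab]].
apply: (ff_set0 Vf); rewrite -ab aX; apply: ff_setI => //.
by apply: EV; split; [exists b|].
Qed.

End Ultrafilters.

(* The set T with the topology whose closed sets are generated by the members *)
(* of C. This is generation by a subbase; closed_genP shows that if C is      *)
(* closed under finite unions then C is a closed base.                        *)
Definition closed_gen {T : Type} (C : set (set T)) : Type := T.

HB.instance Definition _ (T : Type) (C : set (set T)) :=
  gen_eqMixin (closed_gen C).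
HB.instance Definition _ (T : Type) (C : set (set T)) :=
  gen_choiceMixin (closed_gen C).
HB.instance Definition _ (T : Type) (C : set (set T)) :=
  isSubBaseTopological.Build (closed_gen C) [set ~` X | X in C] id.

Lemma closed_genP (T : Type) (C : set (set T)) (Z : set (closed_gen C)) :
  C set0 -> (forall X Y, C X -> C Y -> C (X `|` Y)) ->
  closed Z <-> exists2 G, G `<=` C & Z = \bigcap_(X in G) X.
Proof.
move=> C0 CU; pose B := finI_from [set ~` X | X in C] id.
have openP (U : set (closed_gen C)) :
  open U <-> exists2 D, D `<=` B & \bigcup_(i in D) i = U by [].
have finC X : B X -> C (~` X).
  move=> [D' DC <-]; rewrite setC_bigcap bigcup_fset.
  rewrite big_seq; elim/big_ind: _ => // X' /DC.
  by rewrite inE => -[Y CY <-]; rewrite setCK.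
rewrite -openC openP; split=> [[D DB DZ]|[G GC ->]].
  exists [set ~` X | X in D].
    by move=> _ [X DX <-]; apply: finC; exact: DB.
  by rewrite -[LHS]setCK -DZ setC_bigcup bigcap_image.
exists [set ~` X | X in G]; last first.
  by rewrite setC_bigcap bigcup_image.
move=> _ [X GX <-]; exists [fset (~` X)%classic]%fset.
  by move=> Y /fset1P ->; rewrite inE; exists X => //; exact: GC.
apply/seteqP; split=> l; first by move=> h; apply: (h (~` X)); exact: fset11.
by move=> Xl Y /= /fset1P ->.
Qed.

Section Omega.
Variables (A : comNzRingType) (L : Type) (f : A -> set L).

Definition ultrafilters : Type := {U : set (set L) | f_ultrafilter f U}.

Definition bar (a : A) : set ultrafilters := [set U | sval U (f a)].

Definition Omega : Type := closed_gen (range bar).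
HB.instance Definition _ := Topological.on Omega.

Definition E_map (hf : associated_transition_map f) :
    closed_gen (range f) -> Omega :=
  fun l => exist _ (E_ f l) (E_ultrafilter l hf).

End Omega.

Arguments bar {A L} f a.

Section ClosedBases.
Variables (A : comNzRingType) (L : Type) (f : A -> set L).
Hypothesis hf : associated_transition_map f.

Lemma closed_rangeP (Z : set (closed_gen (range f))) :
  closed Z <-> exists2 G, G `<=` range f & Z = \bigcap_(X in G) X.
Proof.
apply: closed_genP; first by exists 1; rewrite ?associated1.
by move=> _ _ [a _ <-] [b _ <-]; exists (a * b); rewrite ?associatedM.
Qed.

Lemma f_ultrafilter_meet (U : set (set L)) a : f_ultrafilter f U ->
  ~ U (f a) -> exists2 W, U W & W `&` f a = set0.
Proof.
move=> [Uf Umax] Ua; apply: contrapT => nW; apply: Ua.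
pose V := [set Z | range f Z /\ exists2 W, U W & W `&` f a `<=` Z].
have Va W : U W -> V (W `&` f a).
  move=> UW; split; last by exists W.
  by have [w _ <-] := ff_sub Uf UW; have [c ->] := associatedI hf w a; exists c.
suff : V = U.
  move=> VU; have [W UW] := ff_nonempty Uf.
  by rewrite -VU; split; [exists a|exists W => //; exact: subIsetr].
apply: Umax; last by move=> W UW; split; [exact: ff_sub UW|exists W].
split.
- by move=> Z [].
- by have [W UW] := ff_nonempty Uf; exists (W `&` f a); exact: Va.
- by move=> [_ [W UW]]; rewrite subset0 => W0; apply: nW; exists W.
- move=> X Y [[x _ <-] [W UW Wx]] [[y _ <-] [W' UW' Wy]]; split.
    by have [c ->] := associatedI hf x y; exists c.
  exists (W `&` W'); first exact: (ff_setI Uf).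
  by move=> l [[Wl W'l] al]; split; [exact: Wx|exact: Wy].
- move=> b c [_ [W UW Wb]] bc; split; first by exists c.
  by exists W => //; exact: subset_trans bc.
Qed.

Lemma closed_OmegaP (Z : set (Omega f)) :
  closed Z <-> exists2 G, G `<=` range (bar f) & Z = \bigcap_(X in G) X.
Proof.
apply: closed_genP.
  exists 1 => //; apply/seteqP; split=> // -[U [Uf Umax]] /=.
  by rewrite /bar /= (associated1 hf) => /(ff_set0 Uf).
move=> _ _ [a _ <-] [b _ <-]; exists (a * b) => //.
apply/seteqP; split=> -[U Uu] /=; rewrite /bar /= (associatedM hf); last first.
  by case=> Ux; rewrite -(associatedM hf); apply: (ff_up Uu.1 Ux);
    rewrite (associatedM hf); [exact: subsetUl|exact: subsetUr].
move=> Uab; apply: contrapT => /not_orP[].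
move=> /(f_ultrafilter_meet Uu)[W UW Wa] /(f_ultrafilter_meet Uu)[W' UW' Wb].
apply: (ff_set0 Uu.1).
rewrite (_ : set0 = W `&` W' `&` (f a `|` f b)).
  exact: (ff_setI Uu.1 (ff_setI Uu.1 UW UW') Uab).
apply/esym; rewrite -subset0 => l [[Wl W'l] [al|bl]].
  by rewrite -Wa.
by rewrite -Wb.
Qed.

End ClosedBases.

(* Main.v *)
(* The pm-property yields, for comaximal [x] and [y], elements [r] and [s]    *)
(* with [(1 - r x)(1 - s y) = 0]: otherwise a prime ideal avoiding all such   *)
(* products lies below a maximal ideal containing [x] and one containing [y]. *)
(* Disjoint members of [g(B)] come from comaximal elements, so this makes     *)
(* [g(B)] normal: disjoint members are separated by two members covering [K]. *)
(* For an ultrafilter [U], the [g b] with [f (phi b)] in [U] meet by          *)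
(* compactness, in a single point by normality and primality of [U]; that     *)
(* point is the value of the extension at [U].                                *)
Require Import Defs.
From HB Require Import structures.
From mathcomp Require Import all_boot all_order all_algebra.
From mathcomp Require Import ring_quotient ring.
From mathcomp Require Import boolp classical_sets functions topology.

Set Implicit Arguments.
Unset Strict Implicit.
Unset Printing Implicit Defensive.

Import GRing.Theory.

Local Open Scope classical_set_scope.
Local Open Scope ring_scope.

(** Call [k] a limit of the ultrafilter [U] when [g b] contains [k] for every [b] with [f (phi b)]
    in [U]. Limits exist ([ultrafilter_limit]) and are unique ([ultrafilter_limit_unique]). Taking
    limits is continuous ([continuous_limit]): by normality, the limit lies in [g b] exactly when
    [U] contains [f (phi u)] for all [u] such that some [g v] is disjoint from [g b] and covers [K]
    together with [g u]. Conversely, a closed set of [Omega f] containing [E_ f l] for all [l] in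
    [f a] contains every ultrafilter having [f a] as a member, so the values of any continuous
    extension are limits ([continuous_extension_limit]). *)

(** * Prime and maximal ideals by avoidance, and comaximal elements of pm-rings *)

Section IdealsAvoidingASet.
Variable D : comNzRingType.
Implicit Types I J P T : set D.

(* Unlike [idealr_closed], this allows the unit ideal.                        *)
Definition ideal I : Prop :=
  I 0 /\ forall a x y, I x -> I y -> I (a * x + y).

Definition adjoin I x : set D := [set z | exists p r, I p /\ z = p + r * x].

Lemma ideal_adjoin I x : ideal I -> ideal (adjoin I x).
Proof.
move=> [I0 IM]; split; first by exists 0, 0; rewrite mul0r addr0.
move=> a _ _ [p [r [Ip ->]]] [q [s [Iq ->]]].
by exists (a * p + q), (a * r + s); split; [exact: IM|ring].
Qed.

Lemma sub_adjoin I x : I `<=` adjoin I x.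
Proof. by move=> p Ip; exists p, 0; rewrite mul0r addr0. Qed.

Lemma mem_adjoin I x : ideal I -> adjoin I x x.
Proof. by move=> [I0 _]; exists 0, 1; rewrite mul1r add0r. Qed.

Lemma idealr_closed_asbool I : ideal I -> ~ I 1 ->
  idealr_closed (fun x => `[< I x >]).
Proof.
move=> [I0 IM] I1; split; [exact/asboolP|exact/asboolPn|].
by move=> a x y /asboolP Ix /asboolP Iy; exact/asboolP/IM.
Qed.

Lemma idealr_closed_ideal (P : {pred D}) : idealr_closed P -> ideal [set` P].
Proof. by case=> P0 _ PM; split=> // a x y Px Py; exact: PM. Qed.

Lemma ideal_avoiding I T : ideal I -> I `&` T = set0 ->
  exists P, [/\ ideal P, I `<=` P, P `&` T = set0 &
    forall J, ideal J -> P `<=` J -> J `&` T = set0 -> J = P].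
Proof.
move=> idI IT.
(* Zorn is applied to [X] with [I] added, so that the union of the empty chain also qualifies. *)
pose Q X := ideal (I `|` X) /\ (I `|` X) `&` T = set0.
have [|X [[idX XT] Xmax]] := @Zorn_bigcup D Q.
  move=> F FQ Ftot; split; last first.
    rewrite -subset0 => x [[Ix|[X FX Xx]] Tx]; first by rewrite -IT.
    by have [_ <-] := FQ _ FX; split=> //; right.
  split; first by left; exact: idI.1.
  have FU X a x y : F X -> (I `|` X) x -> (I `|` X) y ->
      (I `|` \bigcup_(X in F) X) (a * x + y).
    move=> FX Xx Xy; have [[_ XM] _] := FQ _ FX.
    by case: (XM a x y Xx Xy) => ?; [left|right; exists X].
  move=> a x y [Ix|[X FX Xx]] [Iy|[Y FY Yy]].
  - by left; exact: idI.2.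
  - by apply: (FU Y) => //; [left|right].
  - by apply: (FU X) => //; [right|left].
  - case: (Ftot _ _ FX FY) => XY.
      by apply: (FU Y) => //; right=> //; exact: XY.
    by apply: (FU X) => //; right=> //; exact: XY.
exists (I `|` X); split=> //.
move=> J idJ IXJ JT; have IJ : I `|` J = J.
  by apply/setUidPr => x Ix; apply: IXJ; left.
apply/seteqP; split=> // x Jx; right; apply: contrapT => nXx.
apply: (Xmax J); last by rewrite /Q IJ.
by split=> [y Xy|JX]; [apply: IXJ; right|exact/nXx/JX].
Qed.

(** An ideal maximal among those disjoint from [T] is prime: if [u] and [v] lie outside it,
    adjoining either one meets [T], and the product of the two elements found is in [T], hence so is
    [u * v] outside the ideal. *)
Lemma prime_avoiding I T : ideal I -> T 1 ->
    (forall x y, T x -> T y -> T (x * y)) -> I `&` T = set0 ->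
  exists P : {pred D}, [/\ idealr_closed P, prime_idealr_closed P,
    forall x, I x -> x \in P & forall x, T x -> x \notin P].
Proof.
move=> idI T1 TM /(ideal_avoiding idI)[P [idP IP PT Pmax]].
have PTx x : P x -> ~ T x by move=> Px Tx; rewrite -[False]/(set0 x) -PT.
have meetT u : ~ P u -> exists p r, P p /\ T (p + r * u).
  move=> Pu; apply: contrapT => nT; apply: Pu.
  rewrite -(Pmax (adjoin P u)); first exact: mem_adjoin.
  - exact: ideal_adjoin.
  - exact: sub_adjoin.
  - rewrite -subset0 => z [[p [r [Pp zE]]] Tz].
    by apply: nT; exists p, r; rewrite -zE.
exists (fun x => `[< P x >]); split.
- by apply: idealr_closed_asbool => // P1; exact: PTx T1.
- move=> u v /asboolP Puv; apply/orP; apply: contrapT.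
  rewrite !asboolE => /not_orP[/meetT[p [r [Pp Tp]]] /meetT[q [s [Pq Tq]]]].
  apply: PTx (TM _ _ Tp Tq).
  have -> : (p + r * u) * (q + s * v) =
    (q + s * v) * p + (r * u * q + (r * s * (u * v) + 0)) by ring.
  by do 3?apply: idP.2 => //; exact: idP.1.
- by move=> x Ix; apply/asboolP/IP.
- by move=> x Tx; apply/asboolP => /PTx.
Qed.

(** Proper ideals are those avoiding the set whose only element is 1. *)
Lemma maximal_ideal_containing I : ideal I -> ~ I 1 ->
  exists M : {pred D}, maximal_ideal M /\ forall x, I x -> x \in M.
Proof.
move=> idI I1; have IT : I `&` [set 1] = set0.
  by rewrite -subset0 => x [Ix x1]; apply: I1; rewrite -x1.
have [M [idM IM MT Mmax]] := ideal_avoiding idI IT.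
exists (fun x => `[< M x >]); split; last by move=> x Ix; apply/asboolP/IM.
split.
  by apply: idealr_closed_asbool => // M1; rewrite -[False]/(set0 (1 : D)) -MT.
move=> J Jcl MJ x; have [_ J1 _] := Jcl.
rewrite -[RHS]/(`[< M x >]) -(Mmax [set` J]) /= ?asboolb //.
- exact: idealr_closed_ideal.
- by move=> y My; apply: MJ; apply/asboolP.
- by rewrite -subset0 => y [/= Jy y1]; move: J1; rewrite -y1 Jy.
Qed.

Lemma pm_ring_comaximal (r s x y : D) : pm_ring D -> r * x + s * y = 1 ->
  exists u v, (1 - u * x) * (1 - v * y) = 0.
Proof.
move=> pmD xy1; apply: contrapT => nxy.
pose T := [set z : D | exists u v, z = (1 - u * x) * (1 - v * y)].
have T1 : T 1 by exists 0, 0; ring.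
have TM z w : T z -> T w -> T (z * w).
  move=> [u [v ->]] [u' [v' ->]].
  by exists (u + u' - u * u' * x), (v + v' - v * v' * y); ring.
have id0 : ideal [set 0 : D].
  by split=> // a _ _ -> ->; rewrite /= mulr0 addr0.
have [|P [Pcl Ppr _ PT]] := prime_avoiding id0 T1 TM.
  rewrite -subset0 => z [-> [u [v uv]]].
  by apply: nxy; exists u, v.
have [M [[Mcl _] PM Muniq]] := pmD P Pcl Ppr.
have idP := idealr_closed_ideal Pcl.
(* If [P] avoids every [1 - u * z], then [P] and [z] generate a proper ideal; a maximal ideal above
   it also contains [P], so it is [M]. *)
have MP z : (forall u, T (1 - u * z)) -> z \in M.
  move=> Tz; have idPz := ideal_adjoin z idP.
  have [|N [maxN PN]] := maximal_ideal_containing idPz.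
    move=> [p [u [/= Pp e]]]; apply/negP: Pp; apply: PT.
    by rewrite (_ : p = 1 - u * z) // e addrK.
  rewrite -(Muniq N maxN) ?PN //; first exact: mem_adjoin.
  by move=> w Pw; apply: PN; exact: sub_adjoin.
have [M0 M1 MM] := Mcl; case/negP: M1.
rewrite -xy1 -[s * y]addr0 !MM //.
- by apply: MP => u; exists u, 0; ring.
- by apply: MP => v; exists 0, v; ring.
Qed.

End IdealsAvoidingASet.

(** * Normality of the family of values of a transition map *)

Section Normality.
Variables (D : comNzRingType) (L : Type) (psi : D -> set L).
Hypothesis psiT : transition_map psi.

Let psiS := tm_semi psiT.

Lemma psiX a n : (0 < n)%N -> psi (a ^+ n) = psi a.
Proof.
elim: n => // -[_ _|n IH _]; first by rewrite expr1.
by rewrite exprS (st_mul psiS) IH // setUid.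
Qed.

Lemma psi_comaximal r x s y : r * x + s * y = 1 -> psi x `&` psi y = set0.
Proof.
move=> xy1; rewrite -subset0 -(st_one psiS) -xy1.
have [c [_ cE cS]] := st_add psiS (r * x) (s * y).
apply: subset_trans cS; rewrite -cE !(st_mul psiS).
by apply: setISS; exact: subsetUr.
Qed.

(** A generator [c] of the principal ideal of two powers has [psi c] empty, so dividing these powers
    by [c] leaves their images under [psi] unchanged. *)
Lemma comaximal_of_disjoint d e : psi d `&` psi e = set0 ->
  exists x y r s, [/\ r * x + s * y = 1, psi x = psi d & psi y = psi e].
Proof.
move=> de0; have [m [n [m0 n0 [c cE]]]] := st_principal psiS de0.
have [x _ xE] : [set r * c | r in setT] (d ^+ m).
  by rewrite -cE; exists 1, 0; ring.
have [y _ yE] : [set r * c | r in setT] (e ^+ n).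
  by rewrite -cE; exists 0, 1; ring.
have [r [s rsE]] : ideal2 (d ^+ m) (e ^+ n) c.
  by rewrite cE; exists 1; rewrite ?mul1r.
have dE : psi d = psi x `|` psi c by rewrite -(psiX d m0) -xE (st_mul psiS).
have eE : psi e = psi y `|` psi c by rewrite -(psiX e n0) -yE (st_mul psiS).
have c0 : psi c = set0.
  by rewrite -subset0 -de0 dE eE => l cl; split; right.
exists x, y, r, s; split; [|by rewrite dE c0 setU0|by rewrite eE c0 setU0].
(* [c] need not be cancellable, but [psi] detects zero and [psi c] is empty.  *)
apply/esym/subr0_eq/(st_full psiS); rewrite -[LHS]set0U -c0 -(st_mul psiS).
apply/(st_full psiS).
rewrite mulrBr mulr1 {1}rsE -xE -yE.
by ring.
Qed.

Lemma transition_normal d e : psi d `&` psi e = set0 ->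
  exists u v, [/\ psi u `|` psi v = setT, psi d `&` psi u = set0 &
    psi e `&` psi v = set0].
Proof.
move=> /comaximal_of_disjoint[x [y [r [s [xy1 <- <-]]]]].
have [p [q pq0]] := pm_ring_comaximal (tm_pm psiT) xy1.
(* Each witness is comaximal with the element it must be separated from, and their product is 0. *)
exists (1 - p * x), (1 - q * y); split.
- by rewrite -(st_mul psiS) pq0; apply/(st_full psiS).
- by apply: (psi_comaximal (r := p) (s := 1)); ring.
- by apply: (psi_comaximal (r := q) (s := 1)); ring.
Qed.

End Normality.

(** * Separation and primality for associated transition maps *)

Section AssociatedSeparation.
Variables (A : comNzRingType) (L : Type) (f : A -> set L).
Hypothesis hf : associated_transition_map f.

Lemma associated_normal a b : f a `&` f b = set0 ->
  exists u v, [/\ f u `|` f v = setT, f a `&` f u = set0 &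
    f b `&` f v = set0].
Proof.
have [D [psi [S [h [psiT _ [k hk kh] fE]]]]] := hf.
have [d [s kaE]] := fracP (k a); have [e [t kbE]] := fracP (k b).
rewrite -[a]kh -[b]kh kaE kbE !fE => /(transition_normal psiT)[u [v uv]].
exists (h (Defs.frac u (denom1 S))), (h (Defs.frac v (denom1 S))).
by rewrite !fE.
Qed.

Lemma associated_point_normal l b : ~ f b l ->
  exists u v, [/\ f u `|` f v = setT, ~ f u l & f b `&` f v = set0].
Proof.
move=> /(associated_sep hf)[a [al]]; rewrite setIC.
move=> /associated_normal[u [v [uv au bv]]]; exists u, v; split=> // ul.
by rewrite -[False]/(set0 l) -au.
Qed.

(** (T1) does not say which of the two points the set contains; (T2) replaces a set containing only
    [l2] by a disjoint one containing [l1]. *)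
Lemma associated_eq l1 l2 : (forall a, f a l1 -> f a l2) -> l1 = l2.
Proof.
have [D [psi [S [h [psiT _ _ fE]]]]] := hf.
move=> l12; apply: contrapT => /(tm_T1 psiT)[a [[a1 a2]|[a2 a1]]].
  by move: (l12 (h (Defs.frac a (denom1 S)))); rewrite fE => /(_ a1).
have [b [b1 ab]] := tm_T2 psiT a1.
move: (l12 (h (Defs.frac b (denom1 S)))); rewrite fE => /(_ b1) b2.
by rewrite -[False]/(set0 l2) -ab.
Qed.

Lemma f_ultrafilter_prime U a b : f_ultrafilter f U -> f a `|` f b = setT ->
  U (f a) \/ U (f b).
Proof.
move=> Uu ab; apply: contrapT => /not_orP[].
move=> /(f_ultrafilter_meet hf Uu)[W UW Wa].
move=> /(f_ultrafilter_meet hf Uu)[W' UW' Wb].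
apply: (ff_set0 Uu.1); rewrite (_ : set0 = W `&` W').
  exact: (ff_setI Uu.1).
by apply/esym; rewrite -[LHS]setIT -ab setIUr setIAC Wa set0I -setIA Wb
  setI0 setU0.
Qed.

End AssociatedSeparation.

(** * Limits of ultrafilters and the continuous extension *)

Section Extension.
Variables (A B : comNzRingType) (L K : Type).
Variables (f : A -> set L) (g : B -> set K).
Hypothesis hf : associated_transition_map f.
Hypothesis hg : associated_transition_map g.
Hypothesis K_compact : compact [set: closed_gen (range g)].
Variables (sigma : L -> K) (phi : B -> A).
Hypothesis f_phi : forall b, f (phi b) = sigma @^-1` g b.

Lemma closed_generator b : closed (g b : set (closed_gen (range g))).
Proof.
apply/(closed_rangeP hg); exists [set g b]; last by rewrite bigcap_set1.
by move=> _ ->; exists b.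
Qed.

Lemma phi_cover U u v : f_ultrafilter f U -> g u `|` g v = setT ->
  U (f (phi u)) \/ U (f (phi v)).
Proof.
move=> Uu uv; apply: (f_ultrafilter_prime hf Uu).
by rewrite !f_phi -preimage_setU uv preimage_setT.
Qed.

(** The relevant [g b] form a filter base, nonempty because their preimages under [sigma] belong to
    [U]; a cluster point lies in each of them, as they are closed. *)
Lemma ultrafilter_limit U : f_ultrafilter f U ->
  exists k : K, forall b, U (f (phi b)) -> g b k.
Proof.
move=> [Uf _].
pose F : set_system (closed_gen (range g)) :=
  filter_from [set b | U (f (phi b))] g.
have FF : ProperFilter F.
  apply: filter_from_proper; first apply: filter_from_filter.
  - exists 0; have [W UW] := ff_nonempty Uf.
    have [a _ aW] := ff_sub Uf UW; move: UW; rewrite -aW /= => Ua.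
    by apply: (ff_up Uf Ua); rewrite f_phi (associated0 hg) preimage_setT.
  - move=> b c /= Ub Uc; have [d dE] := associatedI hg b c; exists d.
      by rewrite /= f_phi -dE preimage_setI -!f_phi; exact: (ff_setI Uf).
    by rewrite dE.
  - move=> b /= Ub; apply/set0P/eqP => b0; apply: (ff_set0 Uf).
    by move: Ub; rewrite f_phi b0 preimage_set0.
have [k [_ Fk]] := K_compact FF filterT.
exists k => b Ub; apply: (@closed_generator b) => N kN.
by apply: Fk => //; exists b.
Qed.

Lemma ultrafilter_limit_unique U k1 k2 : f_ultrafilter f U ->
  (forall b, U (f (phi b)) -> g b k1) -> (forall b, U (f (phi b)) -> g b k2) ->
  k1 = k2.
Proof.
move=> Uu U1 U2; apply: (associated_eq hg) => a a1; apply: contrapT => a2.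
have [u [v [uv u2 av]]] := associated_point_normal hg a2.
have [/U2//|/U1 v1] := phi_cover Uu uv.
by rewrite -[False]/(set0 k1) -av.
Qed.

Lemma continuous_limit (s : Omega f -> closed_gen (range g)) :
  (forall U b, sval U (f (phi b)) -> g b (s U)) -> continuous s.
Proof.
move=> sP; apply/continuous_closedP => Z /(closed_rangeP hg)[G Gg ->].
rewrite preimage_bigcap; apply: closed_bigI => _ /Gg[b _ <-].
apply/(closed_OmegaP hf).
exists [set bar f (phi u) | u in [set u | exists v,
    g u `|` g v = setT /\ g b `&` g v = set0]].
  by move=> _ [u _ <-]; exists (phi u).
apply/seteqP; split=> [U /= bU _ [u [v [uv bv]] <-]|U /= GU].
  have [//|/sP vU] := phi_cover (svalP U) uv.
  by have : (g b `&` g v) (s U) by []; rewrite bv.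
apply: contrapT => /(associated_point_normal hg)[u [v [uv nu bv]]].
by apply/nu/sP/(GU (bar f (phi u))); exists u => //; exists v.
Qed.

Lemma continuous_extension_limit (s : Omega f -> closed_gen (range g)) :
    continuous s -> s \o E_map hf = sigma ->
  forall U b, sval U (f (phi b)) -> g b (s U).
Proof.
move=> /continuous_closedP scl sE U b Ub.
have /(closed_OmegaP hf)[G Gbar GE] := scl _ (@closed_generator b).
rewrite -[g b (s U)]/((s @^-1` g b) U) GE => X GX.
have [a _ aX] := Gbar _ GX.
rewrite -aX; apply: (ff_up (svalP U).1 Ub) => l; rewrite f_phi -sE /= => bl.
have : (s @^-1` g b) (E_map hf l) by [].
by rewrite GE => /(_ _ GX); rewrite -aX => -[].
Qed.

End Extension.

Theorem theorem7p7 (A B : comNzRingType) (Lam K : Type)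
    (f : A -> set Lam) (g : B -> set K)
    (hf : associated_transition_map f) (hg : associated_transition_map g)
    (K_compact : compact [set: closed_gen (range g)])
    (sigma : closed_gen (range f) -> closed_gen (range g))
    (sigma_cont : continuous sigma)
    (sigma_lift : exists phi : {rmorphism B -> A},
       forall b, f (phi b) = sigma @^-1` g b) :
  exists! sbar : Omega f -> closed_gen (range g),
    continuous sbar /\ sbar \o E_map hf = sigma.
Proof.
have [phi f_phi] := sigma_lift.
have [s sP] := choice (fun U : Omega f =>
  ultrafilter_limit hg K_compact f_phi (svalP U)).
have limit_unique := ultrafilter_limit_unique hf hg f_phi.
exists s; split=> [|t [tcont tE]].
  split; first exact: (continuous_limit hf hg f_phi).
  apply/funext => l; apply: (limit_unique _ _ _ (svalP (E_map hf l))).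
    by move=> b; exact: sP.
  (* [sigma l] is itself a limit of [E_ f l]. *)
  by move=> b [_]; rewrite f_phi.
apply/funext => U; apply: (limit_unique _ _ _ (svalP U)) => b; first exact: sP.
exact: (continuous_extension_limit hg f_phi tcont tE).
Qed.
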